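(* Let $\mathcal{H}$ be a separable complex Hilbert space. Each g-Bessel multiplier is a Bessel multiplier: if $\Lambda=\{\Lambda_i\}_{i\in J}$ and $\Theta=\{\Theta_i\}_{i\in J}$ are g-Bessel sequences for $\mathcal{H}$ with respect to $\{\mathcal{H}_i\}_{i\in J}$ and $m=(m_i)_{i\in J}$ is a sequence of scalars, then there exist Bessel sequences $\Psi$, $\Phi$ in $\mathcal{H}$ and a scalar sequence $m'$ (all over a common countable index set) such that $\mathbb{M}_{m,\Lambda,\Theta}=\mathbb{M}_{m',\Phi,\Psi}$. Furthermore, if $m\in\ell^{\infty}$ and $\Lambda$, $\Theta$ are g-Bessel sequences for $\mathcal{H}$ with bounds $B_\Lambda$, $B_\Theta$ respectively, then the multiplier $\mathbb{M}_{m,\Lambda,\Theta}$ is well defined on $\mathcal{H}$ and $\|\mathbb{M}_{m,\Lambda,\Theta}\|\le\sqrt{B_\Lambda B_\Theta}\,\|m\|_\infty$.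
   Context: $J\subseteq\mathbb{Z}$ is an index set, $\{\mathcal{H}_i\}_{i\in J}$ is a sequence of separable complex Hilbert spaces, and $\mathcal{L}(\mathcal{H},\mathcal{H}_i)$ is the set of bounded linear operators $\mathcal{H}\to\mathcal{H}_i$. A family $\{\Lambda_i\}_{i\in J}$, $\Lambda_i\in\mathcal{L}(\mathcal{H},\mathcal{H}_i)$, is a g-Bessel sequence for $\mathcal{H}$ with bound $B>0$ if $\sum_{i\in J}\|\Lambda_if\|^2\le B\|f\|^2$ for all $f\in\mathcal{H}$. A family $(\psi_n)$ in $\mathcal{H}$ is a Bessel sequence if for some $B>0$, $\sum_n|\langle f,\psi_n\rangle|^2\le B\|f\|^2$ for all $f\in\mathcal{H}$. The g-Bessel multiplier is $\mathbb{M}_{m,\Lambda,\Theta}f=\sum_{i\in J}m_i\Lambda_i^{\star}\Theta_if$. The Bessel multiplier for Bessel sequences $\Psi=(\psi_n)$, $\Phi=(\phi_n)$ and weights $m'=(m'_n)$ is $\mathbb{M}_{m',\Psi,\Phi}f=\sum_nm'_n\langle f,\psi_n\rangle\phi_n$. Both are operators on the set of $f\in\mathcal{H}$ for which the series converges in norm, and are ''well defined on $\mathcal{H}$'' if the series converges for every $f\in\mathcal{H}$. If the index set consists of pairs $(i,k)$ with $i\in J$, $k\in K_i$, the series is read as the iterated sum $\sum_{i\in J}\sum_{k\in K_i}$. *)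

(* Defs.v *)
From HB Require Import structures.
From mathcomp Require Import all_boot all_order all_algebra.
From mathcomp Require Import all_classical all_reals all_analysis.
From mathcomp Require Import complex.

Set Implicit Arguments.
Unset Strict Implicit.
Unset Printing Implicit Defensive.

Import Order.TTheory GRing.Theory Num.Theory.
Import numFieldNormedType.Exports.

Local Open Scope classical_set_scope.
Local Open Scope ring_scope.

(* The inner product is linear in its first argument and conjugate-linear in
   its second one. *)
HB.mixin Record isHilbert (R : realType) H
    of CompleteNormedModule R[i] H := {
  inner : {dot H for (@Num.conj R[i])} ;
  sqr_normE : forall x : H, `|x| ^+ 2 = inner x x }.

#[short(type="hilbertType")]
HB.structure Definition Hilbert (R : realType) :=
  {H of isHilbert R H & CompleteNormedModule R[i] H}.

(* For a norm over R[i], `|x| is a (nonnegative real) element of R[i];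
   rnorm x is the same number, as an element of R. *)
Definition rnorm (R : realType) (V : normedZmodType R[i]) (x : V) : R :=
  complex.Re `|x|.

Definition separable_space (T : topologicalType) : Prop :=
  exists2 A : set T, countable A & dense A.

Section Operators.
Context {R : realType}.

Definition bounded_operator (H K : hilbertType R) (T : H -> K) : Prop :=
  exists M : R, forall x, rnorm (T x) <= M * rnorm x.

Definition adjoint (H K : hilbertType R) (T : H -> K) (y : K) : H :=
  xget 0 [set x | forall z, inner (T z) y = inner z x].

Definition opnorm (H K : hilbertType R) (T : H -> K) : \bar R :=
  ereal_sup [set (rnorm (T x))%:E | x in [set x | rnorm x <= 1]].

End Operators.

Section Series.
Context {R : realType} {H : hilbertType R}.

(* A series indexed by J `<=` Z is the limit of the sums over J `&` [-a, b] as
   a and b tend to infinity independently. For J = N (resp. J finite) this is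
   the usual series (resp. the finite sum). *)
Definition partial_sums (J : set int) (x : int -> H) (n : nat * nat) : H :=
  \sum_(i \in J `&` [set i : int | - (n.1)%:Z <= i <= (n.2)%:Z]) x i.

Definition series_cvg (J : set int) (x : int -> H) : Prop :=
  cvg (partial_sums J x n @[n --> filter_prod \oo \oo]).

Definition series_sum (J : set int) (x : int -> H) : H :=
  lim (partial_sums J x n @[n --> filter_prod \oo \oo]).

Definition iterated_cvg (J : set int) (K : int -> set int)
    (x : int * int -> H) : Prop :=
  (forall i, J i -> series_cvg (K i) (fun k => x (i, k))) /\
  series_cvg J (fun i => series_sum (K i) (fun k => x (i, k))).

Definition iterated_sum (J : set int) (K : int -> set int)
    (x : int * int -> H) : H :=
  series_sum J (fun i => series_sum (K i) (fun k => x (i, k))).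

End Series.

Section Multipliers.
Context {R : realType} {H : hilbertType R}.

Definition bessel_seq (I : choiceType) (D : set I) (psi : I -> H) : Prop :=
  exists2 B : R, 0 < B & forall f : H,
    (\esum_(n in D) (rnorm (inner f (psi n)) ^+ 2)%:E
       <= (B * rnorm f ^+ 2)%:E)%E.

Definition gbessel_bound (Hs : int -> hilbertType R) (J : set int)
    (Lam : forall i, H -> Hs i) (B : R) : Prop :=
  0 < B /\ forall f : H,
    (\esum_(i in J) (rnorm (Lam i f) ^+ 2)%:E <= (B * rnorm f ^+ 2)%:E)%E.

Definition gbessel_seq (Hs : int -> hilbertType R) (J : set int)
    (Lam : forall i, H -> Hs i) : Prop :=
  exists B : R, gbessel_bound J Lam B.

(* Each multiplier is a partial operator: its domain of definition, together
   with its value, which is only meaningful on that domain. *)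
Definition gmultiplier_term (Hs : int -> hilbertType R) (m : int -> R[i])
    (Lam The : forall i, H -> Hs i) (f : H) (i : int) : H :=
  m i *: adjoint (Lam i) (The i f).

Definition gmultiplier_dom (Hs : int -> hilbertType R) (J : set int)
    (m : int -> R[i]) (Lam The : forall i, H -> Hs i) : set H :=
  [set f | series_cvg J (gmultiplier_term m Lam The f)].

Definition gmultiplier (Hs : int -> hilbertType R) (J : set int)
    (m : int -> R[i]) (Lam The : forall i, H -> Hs i) (f : H) : H :=
  series_sum J (gmultiplier_term m Lam The f).

Definition multiplier_term (m : int * int -> R[i]) (Psi Phi : int * int -> H)
    (f : H) (n : int * int) : H :=
  (m n * inner f (Psi n)) *: Phi n.

Definition multiplier_dom (J : set int) (K : int -> set int)
    (m : int * int -> R[i]) (Psi Phi : int * int -> H) : set H :=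
  [set f | iterated_cvg J K (multiplier_term m Psi Phi f)].

Definition multiplier (J : set int) (K : int -> set int)
    (m : int * int -> R[i]) (Psi Phi : int * int -> H) (f : H) : H :=
  iterated_sum J K (multiplier_term m Psi Phi f).

End Multipliers.

Definition in_linfty (R : realType) (J : set int) (m : int -> R[i]) : Prop :=
  has_ubound [set rnorm (m i) | i in J].

(* sup set0 = 0, so the norm is 0 when J is empty. *)
Definition linfty_norm (R : realType) (J : set int) (m : int -> R[i]) : R :=
  sup [set rnorm (m i) | i in J].

(* Main.v *)
Require Import Defs.
From mathcomp Require Import all_boot all_order all_algebra.
From mathcomp Require Import all_classical all_reals all_analysis.
From mathcomp Require Import complex ring lra.
From mathcomp Require zify.

Set Implicit Arguments.
Unset Strict Implicit.
Unset Printing Implicit Defensive.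

Import Order.TTheory GRing.Theory Num.Theory.
Import numFieldNormedType.Exports.

Local Open Scope classical_set_scope.
Local Open Scope ring_scope.

(* Each separable space [Hs i] contains a sequence [e i] of mutually orthogonal
   vectors, each of norm 1 or equal to 0, along which every vector expands. Then
   [Lam_i^* The_i f = sum_k <The_i f, e_ik> Lam_i^* e_ik
                    = sum_k <f, The_i^* e_ik> Lam_i^* e_ik],
   so the families [The_i^* e_ik] and [Lam_i^* e_ik], with the weights [m i],
   give the same multiplier; they are Bessel by Bessel's inequality in [Hs i].
   If [m] is bounded, let [v] be a finite sum of the series. Moving [Lam_i^*]
   to the other side of [<v, v>], Cauchy-Schwarz gives
   [|v|^2 <= |m|_oo sqrt (sum |The_i f|^2) sqrt (B_Lam) |v|], which yields both
   the Cauchy criterion and the norm estimate. *)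

(** * Real-valued norms, convergence, and a finite Cauchy-Schwarz inequality *)

Section RealNorm.
Context {R : realType}.

Lemma normr_rnorm (V : normedZmodType R[i]) (x : V) : `|x| = (rnorm x)%:C%C.
Proof.
have := normr_ge0 x; rewrite /rnorm; case: `|x| => a b.
by rewrite lecE /= => /andP[/eqP-> _].
Qed.

Lemma rnorm_ge0 (V : normedZmodType R[i]) (x : V) : 0 <= rnorm x.
Proof. by have := normr_ge0 x; rewrite normr_rnorm lecR. Qed.

Lemma rnormD (V : normedZmodType R[i]) (x y : V) : rnorm (x + y) <= rnorm x + rnorm y.
Proof. by have := ler_normD x y; rewrite !normr_rnorm -rmorphD lecR. Qed.

Lemma rnorm0 (V : normedZmodType R[i]) : rnorm (0 : V) = 0.
Proof. by rewrite /rnorm normr0. Qed.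

Lemma rnorm_eq0 (V : normedZmodType R[i]) (x : V) : (rnorm x == 0) = (x == 0).
Proof. by rewrite -[RHS]normr_eq0 normr_rnorm eq_complex /= eqxx andbT. Qed.

Lemma rnormB (V : normedZmodType R[i]) (x y : V) : rnorm (x - y) = rnorm (y - x).
Proof. by rewrite /rnorm distrC. Qed.

Lemma rnormZ (V : normedModType R[i]) (a : R[i]) (x : V) :
  rnorm (a *: x) = rnorm a * rnorm x.
Proof. by have := normrZ a x; rewrite !normr_rnorm -rmorphM => /complexI. Qed.

Lemma rnormM (a b : R[i]) : rnorm (a * b) = rnorm a * rnorm b.
Proof. by have := normrM a b; rewrite !normr_rnorm -rmorphM => /complexI. Qed.

Lemma rnormR (r : R) : 0 <= r -> rnorm (r%:C%C : R[i]) = r.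
Proof. by move=> r0; rewrite /rnorm ger0_norm ?lecR. Qed.

Lemma rnorm_sum (V : normedZmodType R[i]) (I : Type) (r : seq I) (F : I -> V) :
  rnorm (\sum_(i <- r) F i) <= \sum_(i <- r) rnorm (F i).
Proof.
elim: r => [|i r IH]; first by rewrite !big_nil rnorm0.
by rewrite !big_cons (le_trans (rnormD _ _))// lerD2l.
Qed.

(** A positive element of [R[i]] is real, so tolerances may be taken in [R]. *)
Lemma rnorm_cvgP (V : normedModType R[i]) (T : Type) (F : set_system T)
    {FF : Filter F} (f : T -> V) (l : V) :
  (f x @[x --> F] --> l) <->
  (forall e : R, 0 < e -> \forall x \near F, rnorm (l - f x) < e).
Proof.
split=> [/cvgrPdist_lt fl e e0|fl].
  have := fl e%:C%C; rewrite ltcR => /(_ e0); apply: filterS => x.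
  by rewrite normr_rnorm ltcR.
apply/cvgrPdist_lt => -[a b]; rewrite ltcE /= => /andP[/eqP-> a0].
by have := fl a a0; apply: filterS => x; rewrite normr_rnorm ltcR.
Qed.

(** Completeness in a form where the centre [l] may vary with the tolerance [e]; in the use below it
    is a partial sum. *)
Lemma rnorm_cauchy_cvg (V : completeNormedModType R[i]) (T : Type)
    (F : set_system T) {FF : ProperFilter F} (f : T -> V) :
  (forall e : R, 0 < e -> exists l : V, \forall x \near F, rnorm (l - f x) < e) ->
  cvg (f x @[x --> F]).
Proof.
move=> fF; apply/cauchy_cvgP/cauchy_exP => -[a b].
rewrite ltcE /= => /andP[/eqP-> a0].
have [l lF] := fF a a0; exists l.
by apply: filterS lF => x lx; rewrite -ball_normE /ball_ /= normr_rnorm ltcR.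
Qed.

(** Stated for maps that respect differences, so that it also covers the conjugate-linear map
    [inner z]. *)
Lemma bounded_additive_cvg (V W : normedModType R[i]) (f : V -> W) (M : R)
    (T : Type) (F : set_system T) {FF : Filter F} (u : T -> V) (l : V) :
  {morph f : x y / x - y} -> (forall x, rnorm (f x) <= M * rnorm x) ->
  u x @[x --> F] --> l -> f (u x) @[x --> F] --> f l.
Proof.
move=> fB fM /rnorm_cvgP ul; apply/rnorm_cvgP => e e0.
have M0 : 0 < `|M| + 1 by rewrite ltr_wpDl.
have := ul (e / (`|M| + 1)); rewrite divr_gt0// => /(_ isT).
apply: filterS => x; rewrite ltr_pdivlMr// -fB => h.
apply: le_lt_trans (fM _) (le_lt_trans _ h).
rewrite mulrC ler_wpM2l ?rnorm_ge0//; have := ler_norm M; lra.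
Qed.

Lemma rnorm_lim_le (V : normedModType R[i]) (T : Type) (F : set_system T)
    {FF : ProperFilter F} (f : T -> V) (l : V) (c : R) :
  f x @[x --> F] --> l -> (forall x, rnorm (f x) <= c) -> rnorm l <= c.
Proof.
move=> /rnorm_cvgP fl fc; apply/ler_addgt0Pr => e e0.
have /filter_ex[x lx] := fl e e0.
have := rnormD (l - f x) (f x); rewrite subrK; have := fc x; lra.
Qed.

Lemma sum_cauchy_schwarz (I : Type) (r : seq I) (a b : I -> R) :
  (forall i, 0 <= a i) -> (forall i, 0 <= b i) ->
  (\sum_(i <- r) a i * b i) ^+ 2 <=
    (\sum_(i <- r) a i ^+ 2) * (\sum_(i <- r) b i ^+ 2).
Proof.
move=> a0 b0; elim: r => [|i r IH]; first by rewrite !big_nil expr0n mul0r.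
rewrite !big_cons; move: IH.
have : 0 <= \sum_(j <- r) a j * b j by apply: sumr_ge0 => j _; rewrite mulr_ge0.
have : 0 <= \sum_(j <- r) a j ^+ 2 by apply: sumr_ge0 => j _; rewrite sqr_ge0.
have : 0 <= \sum_(j <- r) b j ^+ 2 by apply: sumr_ge0 => j _; rewrite sqr_ge0.
move: (\sum_(j <- r) a j * b j) (\sum_(j <- r) a j ^+ 2) (\sum_(j <- r) b j ^+ 2).
(* With the two sums of squares written as [p^2] and [q^2], the induction hypothesis reads
   [s <= p q], and what remains is [(x y + p q)^2 <= (x^2 + p^2) (y^2 + q^2)], whose sides differ by
   [(x q - y p)^2]. *)
move=> s A B /sqr_sqrtr<- /sqr_sqrtr<- s0.
have := sqrtr_ge0 A; have := sqrtr_ge0 B; have := a0 i; have := b0 i.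
move: (a i) (b i) (Num.sqrt A) (Num.sqrt B) => x y p q y0 x0 q0 p0.
rewrite -exprMn ler_pXn2r ?nnegrE ?mulr_ge0// => spq.
apply: (@le_trans _ _ ((x * y + p * q) ^+ 2)).
  by rewrite ler_pXn2r ?nnegrE ?addr_ge0 ?mulr_ge0// lerD2l.
have : 0 <= (x * q - y * p) ^+ 2 by rewrite sqr_ge0.
nra.
Qed.

End RealNorm.

(** * Inner products: linearity, Pythagoras and Cauchy-Schwarz *)

Section InnerProduct.
Context {R : realType} {H : hilbertType R}.
Implicit Types x y z : H.

Lemma inner_conj x y : inner x y = Num.conj (inner y x).
Proof. by rewrite hermC expr0 mul1r. Qed.

Lemma innerDl x y z : inner (x + y) z = inner x z + inner y z.
Proof. exact: linearDl. Qed.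

Lemma innerDr x y z : inner z (x + y) = inner z x + inner z y.
Proof. exact: linearDr. Qed.

Lemma innerBl x y z : inner (x - y) z = inner x z - inner y z.
Proof. exact: linearBl. Qed.

Lemma innerBr x y z : inner z (x - y) = inner z x - inner z y.
Proof. exact: linearBr. Qed.

Lemma inner0r x : inner x 0 = 0.
Proof. exact: linear0r. Qed.

Lemma inner_suml (I : Type) (r : seq I) (F : I -> H) x :
  inner (\sum_(i <- r) F i) x = \sum_(i <- r) inner (F i) x.
Proof. exact: linear_sumlz. Qed.

Lemma inner_sumr (I : Type) (r : seq I) (F : I -> H) x :
  inner x (\sum_(i <- r) F i) = \sum_(i <- r) inner x (F i).
Proof. exact: linear_sumr. Qed.

Lemma innerZl a x y : inner (a *: x) y = a * inner x y.
Proof. by rewrite linearZl_LR. Qed.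

Lemma innerZr a x y : inner x (a *: y) = Num.conj a * inner x y.
Proof. by rewrite linearZr_LR. Qed.

Lemma inner_rnorm x : inner x x = (rnorm x ^+ 2)%:C%C.
Proof. by rewrite -sqr_normE normr_rnorm -rmorphXn. Qed.

Lemma inner_inj x y : (forall z, inner z x = inner z y) -> x = y.
Proof.
move=> xy; apply/eqP; rewrite -subr_eq0 -(dnorm_eq0 (@inner R H)).
by rewrite innerBr xy subrr.
Qed.

Lemma pythagoras x y : inner x y = 0 ->
  rnorm (x + y) ^+ 2 = rnorm x ^+ 2 + rnorm y ^+ 2.
Proof.
move=> xy; apply: (@complexI R); rewrite rmorphD /= -!inner_rnorm.
by rewrite innerDl !innerDr [inner y x]inner_conj xy conjC0 addr0 add0r.
Qed.

(** Splitting [x] into the orthogonal summands [x - a y] and [a y], Pythagoras gives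
    [|a| |y| <= |x|], while [|<x, y>| = |a| |y|^2]. *)
Lemma cauchy_schwarz x y : rnorm (inner x y) <= rnorm x * rnorm y.
Proof.
have [->|y0] := eqVneq y 0; first by rewrite inner0r !rnorm0 mulr0.
have ny : rnorm y != 0 by rewrite rnorm_eq0.
pose a := inner x y / inner y y.
have iy : inner y y != 0 by rewrite dnorm_eq0.
have o : inner (x - a *: y) (a *: y) = 0.
  by rewrite innerZr innerBl innerZl /a divfK// subrr mulr0.
have := pythagoras o; rewrite subrK rnormZ => e.
have aE : rnorm (inner x y) = rnorm a * rnorm y ^+ 2.
  have -> : inner x y = a * (rnorm y ^+ 2)%:C%C by rewrite -inner_rnorm divfK.
  by rewrite rnormM rnormR ?sqr_ge0.
rewrite aE expr2 mulrA ler_wpM2r ?rnorm_ge0//.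
rewrite -(ler_pXn2r (ltn0Sn 1)) ?nnegrE ?mulr_ge0 ?rnorm_ge0// e.
by rewrite lerDr sqr_ge0.
Qed.

End InnerProduct.

(** * Orthonormal systems, Gram-Schmidt and bases of separable spaces *)

Section Orthosystem.
Context {R : realType} {H : hilbertType R}.
Implicit Types (x y z : H) (d e : nat -> H).

Definition normalize x : H := ((rnorm x)^-1)%:C%C *: x.

Lemma normalize_unit x : normalize x = 0 \/ rnorm (normalize x) = 1.
Proof.
rewrite /normalize; have [->|x0] := eqVneq x 0; first by left; rewrite scaler0.
by right; rewrite rnormZ rnormR ?invr_ge0 ?rnorm_ge0// mulVf ?rnorm_eq0.
Qed.

Lemma normalizeK x : x = (rnorm x)%:C%C *: normalize x.
Proof.
rewrite /normalize scalerA -rmorphM /=; have [->|x0] := eqVneq x 0.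
  by rewrite scaler0.
by rewrite divff ?rnorm_eq0// scale1r.
Qed.

(** Zero vectors are allowed: Gram-Schmidt then never has to skip a dependent vector, and
    finite-dimensional spaces also have bases indexed by all of [nat]. *)
Definition orthosystem e :=
  (forall i j, i != j -> inner (e i) (e j) = 0) /\
  (forall i, e i = 0 \/ rnorm (e i) = 1).

Definition proj e n x := \sum_(0 <= k < n) inner x (e k) *: e k.

Lemma inner_unit e k x : e k = 0 \/ rnorm (e k) = 1 ->
  inner x (e k) * inner (e k) (e k) = inner x (e k).
Proof.
by case=> [->|ek]; [rewrite inner0r mul0r|rewrite inner_rnorm ek expr1n mulr1].
Qed.

(** Orthogonality is asked only against [e k] and below [n], which is what is available inside the
    induction proving the Gram-Schmidt vectors orthogonal. *)
Lemma inner_proj e n k x : (k < n)%N ->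
  (forall i, (i < n)%N -> i != k -> inner (e i) (e k) = 0) ->
  e k = 0 \/ rnorm (e k) = 1 ->
  inner (proj e n x) (e k) = inner x (e k).
Proof.
move=> kn ort ek; rewrite /proj inner_suml (bigD1_seq k) ?iota_uniq//=; last first.
  by rewrite mem_index_iota.
rewrite innerZl inner_unit// big1_seq ?addr0// => i /andP[ik].
by rewrite mem_index_iota => /andP[_ ?]; rewrite innerZl ort ?mulr0.
Qed.

Fixpoint gram_schmidt_seq d n : seq H :=
  if n is n'.+1 then
    let s := gram_schmidt_seq d n' in
    rcons s (normalize (d n' - \sum_(v <- s) inner (d n') v *: v))
  else [::].

Definition gram_schmidt d n : H := last 0 (gram_schmidt_seq d n.+1).

Lemma gram_schmidtE d n :
  gram_schmidt d n = normalize (d n - proj (gram_schmidt d) n (d n)).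
Proof.
have E k : gram_schmidt_seq d k = mkseq (gram_schmidt d) k.
  elim: k => // k IH; rewrite [RHS]mkseqS -IH.
  by rewrite /gram_schmidt /= last_rcons.
by rewrite /gram_schmidt /= last_rcons E big_map /proj /index_iota subn0.
Qed.

Lemma gram_schmidt_unit d k : gram_schmidt d k = 0 \/ rnorm (gram_schmidt d k) = 1.
Proof. by rewrite gram_schmidtE; exact: normalize_unit. Qed.

Lemma gram_schmidt_orthosystem d : orthosystem (gram_schmidt d).
Proof.
split=> [|k]; last exact: gram_schmidt_unit.
(* Orthogonality of all pairs below a common bound, by induction on the bound: only the pairs
   involving the last vector are new. *)
have lt n i j : (i < n)%N -> (j < n)%N -> i != j ->
    inner (gram_schmidt d i) (gram_schmidt d j) = 0.
  elim: n i j => // n IH.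
  have last j : (j < n)%N -> inner (gram_schmidt d n) (gram_schmidt d j) = 0.
    move=> jn; rewrite gram_schmidtE innerZl innerBl inner_proj ?subrr ?mulr0//.
      by move=> i ? ?; exact: IH.
    exact: gram_schmidt_unit.
  move=> i j; rewrite !ltnS leq_eqVlt => /predU1P[->|i_n];
    rewrite leq_eqVlt => /predU1P[->|j_n]; rewrite ?eqxx// => ij.
  - exact: last.
  - by rewrite inner_conj last ?conjC0.
  - exact: IH.
by move=> i j; apply: (lt (maxn i j).+1); rewrite ltnS ?leq_maxl ?leq_maxr.
Qed.

(** [d j] is its projection onto the earlier vectors plus a multiple of [e j], so it lies in the
    span of [e 0, ..., e j] and its coefficients along later vectors vanish. *)
Lemma proj_gram_schmidt d n j : (j < n)%N -> proj (gram_schmidt d) n (d j) = d j.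
Proof.
move=> jn; set e := gram_schmidt d.
have [ort unit] := gram_schmidt_orthosystem d.
have step : proj e j.+1 (d j) = d j.
  rewrite /proj big_nat_recr//= -/(proj e j (d j)).
  pose r := d j - proj e j (d j).
  have re : r = (rnorm r)%:C%C *: e j by rewrite /e gram_schmidtE -normalizeK.
  have dr : d j = proj e j (d j) + r by rewrite /r addrC subrK.
  have pe : inner (proj e j (d j)) (e j) = 0.
    rewrite /proj inner_suml big1_seq// => i /andP[_].
    rewrite mem_index_iota => /andP[_ ij].
    by rewrite innerZl ort ?mulr0// ltn_eqF.
  have de : inner (d j) (e j) = inner r (e j) by rewrite {1}dr innerDl pe add0r.
  rewrite de [RHS]dr; congr (_ + _); rewrite {1 2}re innerZl -scalerA.
  congr (_ *: _); case: (unit j); rewrite -/e => ej; first by rewrite ej scaler0.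
  by rewrite inner_rnorm ej expr1n scale1r.
rewrite /proj (@big_cat_nat _ _ _ j.+1)//= -/(proj e j.+1 (d j)) step.
rewrite big1_seq ?addr0// => i /andP[_]; rewrite mem_index_iota => /andP[ji _].
rewrite -step /proj inner_suml big1_seq ?scale0r// => k /andP[_].
rewrite mem_index_iota => /andP[_ kj]; rewrite innerZl ort ?mulr0// ltn_eqF//.
exact: leq_trans ji.
Qed.

Lemma rnorm_orthosum e (r : seq nat) (a : nat -> R[i]) :
  orthosystem e -> uniq r ->
  rnorm (\sum_(k <- r) a k *: e k) ^+ 2 =
    \sum_(k <- r) (rnorm (a k) * rnorm (e k)) ^+ 2.
Proof.
move=> [ort _]; elim: r => [|k r IH] /=.
  by move=> _; rewrite !big_nil rnorm0 expr0n.
case/andP=> kr ur; rewrite !big_cons pythagoras ?rnormZ ?IH//.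
rewrite inner_sumr big1_seq// => i /andP[_ ir].
rewrite innerZr innerZl ort ?mulr0//.
by apply: contraNneq kr => ->.
Qed.

Lemma rnorm_orthosum_le e (r : seq nat) (a : nat -> R[i]) :
  orthosystem e -> uniq r ->
  rnorm (\sum_(k <- r) a k *: e k) ^+ 2 <= \sum_(k <- r) rnorm (a k) ^+ 2.
Proof.
move=> oe ur; rewrite rnorm_orthosum//; apply: ler_sum => k _.
by case: (oe.2 k) => ->; rewrite ?rnorm0 ?mulr0 ?mulr1// expr0n sqr_ge0.
Qed.

(** [x - proj e n x] is orthogonal to [proj e n x]. Bessel's inequality and the bound
    [|x - proj e n x| <= |x|] are both read off from this identity. *)
Lemma rnorm_sub_proj e n x : orthosystem e ->
  rnorm x ^+ 2 = rnorm (x - proj e n x) ^+ 2 +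
    \sum_(0 <= k < n) rnorm (inner x (e k)) ^+ 2.
Proof.
move=> oe; have o : inner (x - proj e n x) (proj e n x) = 0.
  rewrite {2}/proj inner_sumr big1_seq// => k /andP[_].
  rewrite mem_index_iota => /andP[_ kn]; rewrite innerZr innerBl.
  by rewrite inner_proj ?subrr ?mulr0//; [move=> i _; exact: oe.1|exact: oe.2].
rewrite -{1}(subrK (proj e n x) x) (pythagoras o); congr (_ + _).
rewrite /proj rnorm_orthosum ?iota_uniq//; apply: eq_bigr => k _.
by case: (oe.2 k) => ->; rewrite ?inner0r ?rnorm0 ?mulr0 ?mulr1.
Qed.

Lemma bessel_inequality e n x : orthosystem e ->
  \sum_(0 <= k < n) rnorm (inner x (e k)) ^+ 2 <= rnorm x ^+ 2.
Proof. by move=> oe; rewrite (rnorm_sub_proj n x oe) lerDr sqr_ge0. Qed.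

Lemma rnorm_sub_proj_le e n x : orthosystem e -> rnorm (x - proj e n x) <= rnorm x.
Proof.
move=> oe; rewrite -(ler_pXn2r (ltn0Sn 1)) ?nnegrE ?rnorm_ge0//.
by rewrite (rnorm_sub_proj n x oe) lerDl sumr_ge0// => k _; rewrite sqr_ge0.
Qed.

Lemma projB e n : {morph proj e n : x y / x - y}.
Proof.
move=> x y; rewrite /proj -sumrB; apply: eq_bigr => k _.
by rewrite innerBl scalerBl.
Qed.

Definition hilbert_basis e :=
  orthosystem e /\ forall x, proj e n x @[n --> \oo] --> x.

Lemma separable_dense_seq : separable_space H ->
  exists d, forall x (r : R), 0 < r -> exists n, rnorm (x - d n) < r.
Proof.
case=> A /pfcard_geP[->|[d]] dA.
  by exfalso; apply: (@dense0 H).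
exists d => x r r0.
have [] := dA (ball x r%:C%C).
- by exists x; apply: ballxx; rewrite ltcR.
- by apply: ball_open; rewrite ltcR.
move=> y [+ Ay]; rewrite -ball_normE /ball_ /= => xy.
have {}xy : rnorm (x - y) < r by rewrite -ltcR -normr_rnorm.
have [n _ dn] := @surj _ _ _ _ d y Ay.
by exists n; rewrite dn.
Qed.

(** Gram-Schmidt is applied to a dense sequence [d]. For [n > j] the projection fixes [d j], so
    [x - proj e n x] equals [(x - d j) - proj e n (x - d j)], of norm at most [|x - d j|]. *)
Lemma exists_hilbert_basis : separable_space H -> exists e, hilbert_basis e.
Proof.
move=> /separable_dense_seq[d dd]; exists (gram_schmidt d).
have oe := gram_schmidt_orthosystem d; split=> // x.
apply/rnorm_cvgP => r r0; have [j xj] := dd x r r0.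
exists j.+1 => //= n jn; apply: le_lt_trans xj.
have := rnorm_sub_proj_le n (x - d j) oe.
by rewrite projB proj_gram_schmidt// opprB addrA subrK.
Qed.

End Orthosystem.

(** * Finite intervals of integers and sums over them *)

Section IntegerSeries.
Import zify.

Definition centered_itv (n : nat * nat) : set int :=
  [set i : int | - (n.1)%:Z <= i <= (n.2)%:Z].

(** Index set of the inner series: a sequence over [nat] is carried on the nonnegative integers,
    with [absz] reading off the index. *)
Definition nonneg_int : set int := [set i : int | 0 <= i].

Lemma finite_centered_itv n : finite_set (centered_itv n).
Proof.
apply: (@sub_finite_set _ _ ((fun k : nat => k%:Z - n.1%:Z) @` `I_(n.1 + n.2).+1)).
  move=> i /= /andP[ni in2]; exists (absz (i + n.1%:Z)) => /=; lia.
exact/finite_image/finite_II.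
Qed.

Lemma finite_sub_centered_itv (F : set int) : finite_set F ->
  exists N : nat, F `<=` centered_itv (N, N).
Proof.
move=> finF; exists (\max_(i <- finmap.enum_fset (fset_set F)) absz i) => i Fi.
have : (absz i <= \max_(i <- finmap.enum_fset (fset_set F)) absz i)%N.
  by apply: (@leq_bigmax_seq _ _ xpredT) => //; rewrite in_fset_set// inE.
rewrite /centered_itv /=; lia.
Qed.

Lemma near_prod_infty (P : set (nat * nat)) (N : nat) :
  (forall n, (N <= n.1)%N -> (N <= n.2)%N -> P n) ->
  \forall n \near filter_prod \oo \oo, P n.
Proof.
move=> NP; exists ([set k | (N <= k)%N], [set k | (N <= k)%N]).
  by split; exact: nbhs_infty_ge.
by move=> n [/= n1 n2]; exact: NP.
Qed.

(** The upper endpoint is included, hence [n.2.+1] terms; the lower one is at most 0 and cuts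
    nothing off. *)
Lemma fsbig_nonneg_itv (V : nmodType) (x : int -> V) (n : nat * nat) :
  \sum_(i \in nonneg_int `&` centered_itv n) x i = \sum_(0 <= k < n.2.+1) x k%:Z.
Proof.
rewrite big_mkord (fsbig_ord _ _ (fun k : nat => x k%:Z)).
apply: (@reindex_fsbig _ _ _ _ _ Posz); split.
- by move=> k /= kn; rewrite /nonneg_int /centered_itv /=; lia.
- by move=> j k _ _ [].
- move=> i [i0 /andP[_ i_n]]; exists (absz i) => /=; move: i0 i_n;
    by rewrite /nonneg_int /=; lia.
Qed.

(** A single list [r] serves every [f], so a vector sum and the sum of its squared coefficients can
    be rewritten over the same indices. *)
Lemma fsbig_nonneg (F : set int) : finite_set F -> F `<=` nonneg_int ->
  exists2 r : seq nat, uniq r &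
    forall (V : nmodType) (f : nat -> V),
      \sum_(i \in F) f (absz i) = \sum_(k <- r) f k.
Proof.
move=> finF F0; exists (map absz (finmap.enum_fset (fset_set F))).
  rewrite map_inj_in_uniq ?finmap.fset_uniq// => i j.
  by rewrite !in_fset_set// !inE => /F0 + /F0; rewrite /nonneg_int /=; lia.
by move=> V f; rewrite fsbig_finite// big_map.
Qed.

End IntegerSeries.

(** * Convergence of two-sided series *)

Section Series.
Context {R : realType} {H : hilbertType R}.
Import zify.
Implicit Types (J : set int) (x : int -> H) (a : int -> R).

Lemma partial_sumsE J x n :
  partial_sums J x n = \sum_(i \in J `&` centered_itv n) x i.
Proof. by []. Qed.

Lemma series_sumE J x l :
  partial_sums J x n @[n --> filter_prod \oo \oo] --> l ->
  series_cvg J x /\ series_sum J x = l.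
Proof.
by move=> xl; split; [exact: cvgP xl | apply: cvg_lim xl; exact: norm_hausdorff].
Qed.

Lemma nonneg_series_sumE x l :
  (\sum_(0 <= k < n) x k%:Z) @[n --> \oo] --> l ->
  series_cvg nonneg_int x /\ series_sum nonneg_int x = l.
Proof.
move=> /rnorm_cvgP xl; apply: series_sumE; apply/rnorm_cvgP => e e0.
have [N _ NP] := xl e e0; apply: (@near_prod_infty _ N) => n _ n2.
by rewrite partial_sumsE fsbig_nonneg_itv; apply: NP => /=; exact: leqW.
Qed.

Lemma esum_le_fsum J a (B : R) :
  (\esum_(i in J) (a i)%:E <= B%:E)%E ->
  forall F, finite_set F -> F `<=` J -> \sum_(i \in F) a i <= B.
Proof.
move=> aB F finF FJ; rewrite -lee_fin -fsumEFin//; apply: le_trans aB.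
by apply: ereal_sup_ubound; exists F.
Qed.

Lemma le_fsum_nneg_subset (A A' : set int) a : finite_set A' -> A `<=` A' ->
  (forall i, A' i -> 0 <= a i) -> \sum_(i \in A) a i <= \sum_(i \in A') a i.
Proof.
move=> finA' AA' a0; rewrite (fsbigID A A')// (setIidr AA') lerDl.
by rewrite fsumr_ge0// => i [/a0].
Qed.

Lemma fsum_centered_itvD (V : nmodType) J (f : int -> V) n N :
  (N <= n.1)%N -> (N <= n.2)%N ->
  \sum_(i \in J `&` centered_itv n) f i =
    \sum_(i \in J `&` centered_itv (N, N)) f i +
    \sum_(i \in J `&` centered_itv n `&` ~` centered_itv (N, N)) f i.
Proof.
move=> n1 n2; rewrite (fsbigID (centered_itv (N, N)) (J `&` centered_itv n)); last first.
  exact: sub_finite_set (@subIsetr _ _ _) (finite_centered_itv n).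
have NN : centered_itv (N, N) `<=` centered_itv n.
  by move=> i; rewrite /centered_itv /=; lia.
by rewrite -[J `&` _ `&` centered_itv (N, N)]setIA (setIidr NN).
Qed.

(** The finite sums of [a] have a supremum, nearly attained on some finite [X]. A finite subset of
    [J] disjoint from an interval containing [X] then has a small [a]-sum, hence a small [x]-sum,
    which is the Cauchy criterion. *)
Lemma dominated_series_cvg J x a (B C : R) :
  (forall i, J i -> 0 <= a i) ->
  (forall F, finite_set F -> F `<=` J -> \sum_(i \in F) a i <= B) ->
  (forall F, finite_set F -> F `<=` J ->
    rnorm (\sum_(i \in F) x i) ^+ 2 <= C * \sum_(i \in F) a i) ->
  series_cvg J x.
Proof.
move=> a0 aB xa.
pose S := [set \sum_(i \in F) a i | F in [set F | finite_set F /\ F `<=` J]].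
have supS : has_sup S.
  split.
    exists (\sum_(i \in set0) a i), set0 => //.
    by split; [exact: finite_set0|exact: sub0set].
  by exists B => _ [F [finF FJ] <-]; exact: aB.
have ubS F : finite_set F -> F `<=` J -> \sum_(i \in F) a i <= sup S.
  by move=> finF FJ; apply: ub_le_sup; [exact: supS.2|exists F].
apply: rnorm_cauchy_cvg => e e0.
have C0 : 0 < `|C| + 1 by rewrite ltr_wpDl.
(* The gap is chosen so that [C] times it stays below [e^2], whatever the sign of [C]. *)
have d0 : 0 < e ^+ 2 / (`|C| + 1) by rewrite divr_gt0// exprn_gt0.
have [_ [X [finX XJ] <-] SX] := sup_adherent d0 supS.
have [N XN] := finite_sub_centered_itv finX.
exists (partial_sums J x (N, N)); apply: (@near_prod_infty _ N) => n n1 n2.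
(* The difference of the two partial sums is the sum over the part of [J] in the larger interval
   that lies outside [[-N, N]]. *)
rewrite rnormB !partial_sumsE (fsum_centered_itvD _ _ n1 n2) addrAC subrr add0r.
set F := _ `&` ~` _.
have finJ k : finite_set (J `&` centered_itv k).
  exact: sub_finite_set (@subIsetr _ _ _) (finite_centered_itv k).
have finF : finite_set F by apply: sub_finite_set (finJ n); exact: subIsetl.
have FJ : F `<=` J by move=> i [[]].
have aF : \sum_(i \in F) a i < e ^+ 2 / (`|C| + 1).
  have := ubS _ (finJ n) (@subIsetl _ _ _).
  rewrite (fsum_centered_itvD _ _ n1 n2) -/F.
  have : \sum_(i \in X) a i <= \sum_(i \in J `&` centered_itv (N, N)) a i.
    apply: le_fsum_nneg_subset => // [i Xi|i [/a0]]//.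
    by split; [exact: XJ|exact: XN].
  lra.
have aF0 : 0 <= \sum_(i \in F) a i by apply: fsumr_ge0 => i /FJ/a0.
rewrite -(ltr_pXn2r (ltn0Sn 1)) ?nnegrE ?rnorm_ge0 ?ltW//.
apply: le_lt_trans (xa _ finF FJ) _.
rewrite ltr_pdivlMr// mulrC in aF; apply: le_lt_trans aF.
by rewrite ler_wpM2r//; have := ler_norm C; lra.
Qed.

End Series.

(** * Existence and properties of adjoints *)

Section Adjoint.
Context {R : realType} {H K : hilbertType R}.
Context (T : {linear H -> K}) (T_bounded : bounded_operator T).

Lemma bounded_operator_ge0 :
  exists2 M : R, 0 <= M & forall x, rnorm (T x) <= M * rnorm x.
Proof.
have [M TM] := T_bounded; exists `|M| => // x.
by apply: le_trans (TM x) _; rewrite ler_wpM2r ?rnorm_ge0 ?ler_norm.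
Qed.

(* Testing [T] against [\sum_(k <- r) inner y (T (e k)) *: e k] gives [s <= c v],
   where [v] is the norm of that vector and [v ^+ 2 <= s]. *)
Lemma adjoint_coef_bound (e : nat -> H) M y (r : seq nat) :
  orthosystem e -> 0 <= M -> (forall x, rnorm (T x) <= M * rnorm x) ->
  uniq r ->
  \sum_(k <- r) rnorm (inner y (T (e k))) ^+ 2 <= (M * rnorm y) ^+ 2.
Proof.
move=> oe M0 TM ur; set s := \sum_(k <- r) _.
pose v := \sum_(k <- r) inner y (T (e k)) *: e k.
have vs : rnorm v ^+ 2 <= s := rnorm_orthosum_le _ oe ur.
have s0 : 0 <= s by apply: sumr_ge0 => k _; rewrite sqr_ge0.
have Tv : inner y (T v) = s%:C%C.
  rewrite /v linear_sum inner_sumr /s rmorph_sum; apply: eq_bigr => k _ /=.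
  by rewrite linearZ innerZr mulrC -normCK normr_rnorm -rmorphXn.
have sc : s <= (M * rnorm y) * rnorm v.
  rewrite -(rnormR s0) -Tv; apply: le_trans (cauchy_schwarz _ _) _.
  by rewrite -mulrA mulrCA ler_wpM2l ?rnorm_ge0.
have c0 : 0 <= M * rnorm y by rewrite mulr_ge0 ?rnorm_ge0.
have v0 := rnorm_ge0 v.
(* With [c = M |y|]: if [|v| <= c] then [s <= c |v| <= c^2]; if [|v| > c] then [|v|^2 <= s <= c |v|]
   is impossible. *)
have [vc|cv] := leP (rnorm v) (M * rnorm y); nra.
Qed.

(** The vector is [sum_k <y, T e_k> e_k], convergent by [adjoint_coef_bound]. Both sides are limits
    of the same finite sums [sum_k <z, e_k> <T e_k, y>], by continuity of [T] and of the inner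
    product. *)
Lemma exists_adjoint (e : nat -> H) y : hilbert_basis e ->
  exists x, forall z, inner (T z) y = inner z x.
Proof.
move=> [oe eb]; have [M M0 TM] := bounded_operator_ge0.
pose x (i : int) := inner y (T (e (absz i))) *: e (absz i).
have xF F : finite_set F -> F `<=` nonneg_int ->
    exists2 r, uniq r &
      \sum_(i \in F) x i = \sum_(k <- r) inner y (T (e k)) *: e k /\
      \sum_(i \in F) rnorm (inner y (T (e (absz i)))) ^+ 2 =
        \sum_(k <- r) rnorm (inner y (T (e k))) ^+ 2.
  move=> finF /(fsbig_nonneg finF)[r ur rE]; exists r => //; split.
    exact: (rE H (fun k => inner y (T (e k)) *: e k)).
  exact: (rE R (fun k => rnorm (inner y (T (e k))) ^+ 2)).
have xc : series_cvg nonneg_int x.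
  apply: (@dominated_series_cvg _ _ _ _
    (fun i => rnorm (inner y (T (e (absz i)))) ^+ 2) ((M * rnorm y) ^+ 2) 1).
  - by move=> i _; rewrite sqr_ge0.
  - move=> F finF /(xF _ finF)[r ur [_ ->]].
    exact: adjoint_coef_bound.
  - move=> F finF /(xF _ finF)[r ur [-> ->]]; rewrite mul1r.
    exact: rnorm_orthosum_le.
have /cvg_ex[l xl] := xc; exists l => z.
have lim1 : inner (T (proj e n.2.+1 z)) y @[n --> filter_prod \oo \oo] -->
    (inner (T z) y : R[i]^o).
  apply: (@bounded_additive_cvg _ _ (R[i]^o) (fun z => inner (T z) y)
    (M * rnorm y)).
  - by move=> u v; rewrite linearB innerBl.
  - move=> u; apply: le_trans (cauchy_schwarz _ _) _.
    by rewrite mulrAC ler_wpM2r ?rnorm_ge0.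
  - apply/rnorm_cvgP => r r0; have /rnorm_cvgP/(_ r r0)[N _ NP] := eb z.
    by apply: (@near_prod_infty _ N) => n _ n2; apply: NP => /=; exact: leqW.
have lim2 : inner z (partial_sums nonneg_int x n) @[n --> filter_prod \oo \oo] -->
    (inner z l : R[i]^o).
  apply: (@bounded_additive_cvg _ _ (R[i]^o) (inner z) (rnorm z)) xl.
    by move=> u v; rewrite innerBr.
  by move=> u; exact: cauchy_schwarz.
have E : (fun n => inner (T (proj e n.2.+1 z)) y) =
         (fun n => inner z (partial_sums nonneg_int x n)).
  apply/funext => n; rewrite partial_sumsE fsbig_nonneg_itv /proj linear_sum.
  rewrite inner_suml inner_sumr; apply: eq_bigr => k _.
  by rewrite linearZ innerZl innerZr mulrC /x /= -inner_conj.
rewrite E in lim1.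
exact: (cvg_unique (@norm_hausdorff _ R[i]^o) lim1 lim2).
Qed.

Context (H_separable : separable_space H).

(** [adjoint] is a choice with default 0; a basis of the separable space [H] yields a vector to
    choose, so the choice has the adjoint property. *)
Lemma adjointP y z : inner (T z) y = inner z (adjoint T y).
Proof.
have [e eb] := exists_hilbert_basis H_separable.
have := exists_adjoint y eb.
by move=> /(@xgetPex _ 0 [set x | forall z, inner (T z) y = inner z x]); apply.
Qed.

Lemma adjointE y z : inner y (T z) = inner (adjoint T y) z.
Proof. by rewrite inner_conj adjointP -inner_conj. Qed.

Lemma adjointB : {morph adjoint T : x y / x - y}.
Proof. by move=> x y; apply: inner_inj => z; rewrite innerBr -!adjointP innerBr. Qed.

Lemma adjointZ a y : adjoint T (a *: y) = a *: adjoint T y.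
Proof. by apply: inner_inj => z; rewrite innerZr -!adjointP innerZr. Qed.

Lemma adjoint_sum (I : Type) (r : seq I) (F : I -> K) :
  adjoint T (\sum_(i <- r) F i) = \sum_(i <- r) adjoint T (F i).
Proof.
apply: inner_inj => z; rewrite -adjointP !inner_sumr.
by apply: eq_bigr => i _; rewrite adjointP.
Qed.

(** With [x] the adjoint image of [y], [|x|^2 = <T x, y> <= M |x| |y|]; then [|x|] is cancelled. *)
Lemma adjoint_bounded M : 0 <= M -> (forall x, rnorm (T x) <= M * rnorm x) ->
  forall y, rnorm (adjoint T y) <= M * rnorm y.
Proof.
move=> M0 TM y; set x := adjoint T y.
have [->|x0] := eqVneq x 0; first by rewrite rnorm0 mulr_ge0 ?rnorm_ge0.
have xp : 0 < rnorm x by rewrite lt_def rnorm_eq0 x0 rnorm_ge0.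
rewrite -(ler_pM2r xp) -expr2 -(rnormR (sqr_ge0 (rnorm x))) -inner_rnorm.
rewrite {2}/x -adjointP; apply: le_trans (cauchy_schwarz _ _) _.
by rewrite mulrAC ler_wpM2r ?rnorm_ge0.
Qed.

End Adjoint.

(** * From g-Bessel sequences to Bessel sequences *)

Section GBesselMultiplier.
Context {R : realType} {H : hilbertType R}.
Context (H_separable : separable_space H).
Context (J : set int) (Hs : int -> hilbertType R).
Implicit Types (L Lam The : forall i, {linear H -> Hs i}) (m : int -> R[i]).
Implicit Types (e : forall i, nat -> Hs i).

Definition adjoint_basis L e (n : int * int) : H :=
  adjoint (L n.1) (e n.1 (absz n.2)).

(** [<f, L_i^* e_ik>] equals [<L_i f, e_ik>], so Bessel's inequality bounds the sum over [k] by
    [|L_i f|^2], and the g-Bessel bound [B] carries over. *)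
Lemma bessel_adjoint_basis L e :
  (forall i, J i -> bounded_operator (L i)) ->
  (forall i, J i -> orthosystem (e i)) -> gbessel_seq J L ->
  bessel_seq (J `*`` (fun=> nonneg_int)) (adjoint_basis L e).
Proof.
move=> bL oe [B [B0 LB]]; exists B => // f.
rewrite -(@esum_esum _ _ _ J (fun=> nonneg_int) (fun i k =>
  (rnorm (inner f (adjoint_basis L e (i, k))) ^+ 2)%:E)); last first.
  by move=> i k _ _; rewrite lee_fin sqr_ge0.
apply: le_trans (LB f); apply: le_esum => i Ji.
apply: ge_ereal_sup => _ [F [finF F0] <-]; rewrite fsumEFin// lee_fin.
have [N FN] := finite_sub_centered_itv finF.
apply: le_trans (bessel_inequality N.+1 (L i f) (oe i Ji)).
have <- : \sum_(k \in nonneg_int `&` centered_itv (N, N))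
      rnorm (inner f (adjoint (L i) (e i (absz k)))) ^+ 2 =
    \sum_(0 <= k < N.+1) rnorm (inner (L i f) (e i k)) ^+ 2.
  rewrite fsbig_nonneg_itv; apply: eq_bigr => k _.
  by rewrite (adjointP (bL i Ji) H_separable).
apply: le_fsum_nneg_subset; last by move=> k _; rewrite sqr_ge0.
  exact: sub_finite_set (@subIsetr _ _ _) (finite_centered_itv _).
by move=> k Fk; split; [exact: F0|exact: FN].
Qed.

(** [m i] times the adjoint of [Lam i] is bounded and linear, so it can be applied termwise to the
    expansion of [The i f] along [e i]. *)
Lemma multiplier_inner_sum m Lam The e f i :
  bounded_operator (Lam i) -> bounded_operator (The i) -> hilbert_basis (e i) ->
  let x := fun k => multiplier_term (fun n => m n.1)
    (adjoint_basis The e) (adjoint_basis Lam e) f (i, k) in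
  series_cvg nonneg_int x /\
  series_sum nonneg_int x = gmultiplier_term m Lam The f i.
Proof.
move=> bL bT [oe eb] x; apply: nonneg_series_sumE.
have -> : (fun n => \sum_(0 <= k < n) x k%:Z) =
    (fun n => m i *: adjoint (Lam i) (proj (e i) n (The i f))).
  apply/funext => n; rewrite /proj adjoint_sum// scaler_sumr; apply: eq_bigr => k _.
  by rewrite adjointZ// scalerA /x /multiplier_term /= -adjointP.
have [M M0 LM] := bounded_operator_ge0 bL.
apply: (@bounded_additive_cvg _ _ _ (fun y => m i *: adjoint (Lam i) y)
  (rnorm (m i) * M)) (eb _).
  by move=> u v; rewrite adjointB// scalerBr.
by move=> u; rewrite rnormZ -mulrA ler_wpM2l ?rnorm_ge0// adjoint_bounded.
Qed.

Lemma partial_sums_eq (x y : int -> H) n :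
  (forall i, J i -> x i = y i) -> partial_sums J x n = partial_sums J y n.
Proof. by move=> xy; apply: eq_fsbigr => i; rewrite inE => -[/xy]. Qed.

(** * Bounded weights: convergence and the norm bound *)

Lemma linfty_norm_ge m i : in_linfty J m -> J i -> rnorm (m i) <= linfty_norm J m.
Proof. by move=> mJ Ji; apply: ub_le_sup => //; exists i. Qed.

Lemma linfty_norm_ge0 m : in_linfty J m -> 0 <= linfty_norm J m.
Proof.
move=> mJ; have [[i Ji]|/set0P/negP/negPn/eqP J0] := pselect (J !=set0).
  exact: le_trans (rnorm_ge0 _) (linfty_norm_ge mJ Ji).
by rewrite /linfty_norm J0 image_set0 sup0.
Qed.

Context (m : int -> R[i]) (Lam The : forall i, {linear H -> Hs i}) (B : R).
Context (Lam_bounded : forall i, J i -> bounded_operator (Lam i)).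
Context (m_linfty : in_linfty J m) (Lam_bessel : gbessel_bound J Lam B).

Lemma gmultiplier_fsum_bound f (F : set int) : finite_set F -> F `<=` J ->
  rnorm (\sum_(i \in F) gmultiplier_term m Lam The f i) ^+ 2 <=
    linfty_norm J m ^+ 2 * B * \sum_(i \in F) rnorm (The i f) ^+ 2.
Proof.
move=> finF FJ; set v := \sum_(i \in F) _; set mu := linfty_norm J m.
set A := \sum_(i \in F) _.
have mu0 : 0 <= mu := linfty_norm_ge0 m_linfty.
have [B0 LB] := Lam_bessel.
pose S := \sum_(i \in F) rnorm (The i f) * rnorm (Lam i v).
have S0 : 0 <= S by apply: fsumr_ge0 => i _; rewrite mulr_ge0 ?rnorm_ge0.
have vS : rnorm v ^+ 2 <= mu * S.
  rewrite -(rnormR (sqr_ge0 (rnorm v))) -inner_rnorm {1}/v fsbig_finite//=.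
  rewrite inner_suml; apply: le_trans (rnorm_sum _ _) _.
  rewrite /S fsbig_finite//= mulr_sumr big_seq [leRHS]big_seq.
  apply: ler_sum => i; rewrite in_fset_set// inE => /FJ Ji.
  rewrite innerZl -adjointE; [|exact: Lam_bounded|exact: H_separable].
  rewrite rnormM; apply: ler_pM; rewrite ?rnorm_ge0//.
    exact: linfty_norm_ge.
  exact: cauchy_schwarz.
have SA : S ^+ 2 <= A * \sum_(i \in F) rnorm (Lam i v) ^+ 2.
  rewrite /S /A !fsbig_finite//.
  by apply: sum_cauchy_schwarz => i; exact: rnorm_ge0.
have LF : \sum_(i \in F) rnorm (Lam i v) ^+ 2 <= B * rnorm v ^+ 2.
  exact: esum_le_fsum (LB v) _ finF FJ.
have A0 : 0 <= A by apply: fsumr_ge0 => i _; rewrite sqr_ge0.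
have v0 := rnorm_ge0 v.
have [->|vn0] := eqVneq (rnorm v) 0.
  by rewrite expr0n !mulr_ge0// ?sqr_ge0// ltW.
have vp : 0 < rnorm v ^+ 2 by rewrite exprn_gt0// lt_def vn0.
(* Multiplied by [|v|^2], the goal follows from [|v|^4 <= (mu S)^2] and [S^2 <= A B |v|^2]. *)
rewrite -(ler_pM2r vp) -expr2; apply: (@le_trans _ _ ((mu * S) ^+ 2)).
  by rewrite ler_pXn2r ?nnegrE ?mulr_ge0 ?sqr_ge0.
rewrite exprMn [leRHS](_ : _ = mu ^+ 2 * (A * (B * rnorm v ^+ 2))); last by ring.
by rewrite ler_wpM2l ?sqr_ge0//; apply: le_trans SA _; rewrite ler_wpM2l.
Qed.

Lemma gmultiplier_partial_bound B' f n : gbessel_bound J The B' ->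
  rnorm (partial_sums J (gmultiplier_term m Lam The f) n) <=
    Num.sqrt (B * B') * linfty_norm J m * rnorm f.
Proof.
move=> [B'0 TB]; have [B0 _] := Lam_bessel.
have mu0 := linfty_norm_ge0 m_linfty.
have finF : finite_set (J `&` centered_itv n).
  exact: sub_finite_set (@subIsetr _ _ _) (finite_centered_itv n).
rewrite -(ler_pXn2r (ltn0Sn 1)) ?nnegrE ?mulr_ge0 ?rnorm_ge0 ?sqrtr_ge0//.
apply: le_trans (gmultiplier_fsum_bound f finF (@subIsetl _ _ _)) _.
rewrite !exprMn sqr_sqrtr ?mulr_ge0 ?(ltW B0) ?(ltW B'0)//.
rewrite [leRHS](_ : _ = linfty_norm J m ^+ 2 * B * (B' * rnorm f ^+ 2)); last by ring.
rewrite ler_wpM2l ?mulr_ge0 ?sqr_ge0 ?(ltW B0)//.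
exact: esum_le_fsum (TB f) _ finF (@subIsetl _ _ _).
Qed.

Lemma gmultiplier_series_cvg f : gbessel_seq J The ->
  series_cvg J (gmultiplier_term m Lam The f).
Proof.
move=> [B' [_ TB]].
apply: (@dominated_series_cvg _ _ _ _ (fun i => rnorm (The i f) ^+ 2)
  (B' * rnorm f ^+ 2) (linfty_norm J m ^+ 2 * B)).
- by move=> i _; rewrite sqr_ge0.
- exact: esum_le_fsum.
- exact: gmultiplier_fsum_bound.
Qed.

Lemma opnorm_gmultiplier B' : gbessel_bound J The B' ->
  (opnorm (gmultiplier J m Lam The)
     <= (Num.sqrt (B * B') * linfty_norm J m)%:E)%E.
Proof.
move=> TB'; apply: ge_ereal_sup => _ [f f1 <-]; rewrite lee_fin.
have TB : gbessel_seq J The by exists B'.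
apply: (@le_trans _ _ (Num.sqrt (B * B') * linfty_norm J m * rnorm f)).
  apply: (rnorm_lim_le (gmultiplier_series_cvg TB)) => n.
  exact: gmultiplier_partial_bound.
by rewrite ler_piMr// mulr_ge0 ?sqrtr_ge0// linfty_norm_ge0.
Qed.

End GBesselMultiplier.

(** * Bessel representation and norm estimate for g-Bessel multipliers *)

Theorem proposition3p1 (R : realType) (H : hilbertType R)
  (Hsep : separable_space H)
  (J : set int) (Hs : int -> hilbertType R)
  (Hssep : forall i, J i -> separable_space (Hs i))
  (Lam The : forall i, {linear H -> Hs i})
  (Lam_bounded : forall i, J i -> bounded_operator (Lam i))
  (The_bounded : forall i, J i -> bounded_operator (The i))
  (m : int -> R[i]) :
  (gbessel_seq J Lam -> gbessel_seq J The ->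
    exists (K : int -> set int) (Phi Psi : int * int -> H)
           (m' : int * int -> R[i]),
      [/\ bessel_seq (J `*`` K) Phi,
          bessel_seq (J `*`` K) Psi,
          gmultiplier_dom J m Lam The = multiplier_dom J K m' Phi Psi
        & forall f, gmultiplier_dom J m Lam The f ->
            gmultiplier J m Lam The f = multiplier J K m' Phi Psi f])
  /\
  (forall B_Lam B_The : R,
    in_linfty J m ->
    gbessel_bound J Lam B_Lam -> gbessel_bound J The B_The ->
    gmultiplier_dom J m Lam The = setT /\
    (opnorm (gmultiplier J m Lam The)
       <= (Num.sqrt (B_Lam * B_The) * linfty_norm J m)%:E)%E).
Proof.
split=> [LB TB|BL BT mJ LB TB]; last first.
  split; last exact: opnorm_gmultiplier.
  apply/seteqP; split=> // f _.
  by apply: (gmultiplier_series_cvg Hsep Lam_bounded mJ LB); exists BT.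
(* Separability of [Hs i] is known only for [i] in [J]; guarding the claim by [J i] lets a sequence
   be chosen for all [i] at once. *)
have ex i : exists e : nat -> Hs i, J i -> hilbert_basis e.
  have [Ji|nJi] := pselect (J i); last by exists (fun=> 0).
  by have [e eb] := exists_hilbert_basis (Hssep i Ji); exists e.
pose e i := projT1 (cid (ex i)).
have eb i : J i -> hilbert_basis (e i) := projT2 (cid (ex i)).
have oe i : J i -> orthosystem (e i) by move=> /eb[].
(* [multiplier_term] pairs [f] with its first family, so the vectors built from [The] come first;
   the weight of [(i, k)] is [m i]. *)
exists (fun=> nonneg_int), (adjoint_basis The e), (adjoint_basis Lam e), (fun n => m n.1).
have sumE f i : J i -> _ := fun Ji => multiplier_inner_sum Hsep m f
  (Lam_bounded i Ji) (The_bounded i Ji) (eb i Ji).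
(* The outer partial sums agree exactly at every [n], so domains and values coincide for arbitrary
   weights [m]. *)
have psE f : partial_sums J (gmultiplier_term m Lam The f) =
    partial_sums J (fun i => series_sum nonneg_int (fun k =>
      multiplier_term (fun n => m n.1)
        (adjoint_basis The e) (adjoint_basis Lam e) f (i, k))).
  by apply/funext => n; apply: partial_sums_eq => i /(sumE f)[_ ->].
split.
- exact: bessel_adjoint_basis.
- exact: bessel_adjoint_basis.
- apply/seteqP; split=> f; rewrite /gmultiplier_dom /multiplier_dom /= /iterated_cvg.
    rewrite /series_cvg psE => fc; split=> // i /(sumE f)[].
    by [].
  by case=> _; rewrite /series_cvg psE.
- by move=> f _; rewrite /gmultiplier /multiplier /iterated_sum /series_sum psE.
Qed.
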